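(* Let $\mathcal{K}$ be a field with a nonarchimedean valuation that has a splitting and an infinite residue field. For every positive integer $n$, \[ \nu(\mathrm{Gr}_{\mathcal{K}}(n,2n))\cap\mathcal{L}_n \;=\; \nu(\mathrm{Fl}_{\mathcal{K}}(n))\cap \mathrm{SUBMOD}_n . \] If moreover $\mathcal{K}$ is algebraically closed or real closed, then \[ \operatorname{trop}(\mathrm{Gr}_{\mathcal{K}}(n,2n))\cap\mathcal{L}_n \;=\; \operatorname{trop}(\mathrm{Fl}_{\mathcal{K}}(n))\cap \mathrm{SUBMOD}_n . \] Here $\mathcal{L}_n$ is identified with $\mathbb{R}^{2^{[n]}}$ via $\phi$.
   Context: The valuation is nontrivial, $\mathrm{val}:\mathcal{K}^*\to\mathbb{R}$, and $\nu=-\mathrm{val}$. A splitting is a group homomorphism $\varphi:\Gamma\to\mathcal{K}^*$ from the value group $\Gamma=\mathrm{val}(\mathcal{K}^* )$ with $\mathrm{val}\circ\varphi=\mathrm{id}$. For $X\subseteq\mathcal{K}^N$, $\nu(X)=\{(\nu(x_i))_i : x\in X, \text{ all } x_i\ne0\}$, and $\operatorname{trop}(X)$ is the Euclidean closure of $\nu(X)$ (for real closed $\mathcal{K}$ the valuation is assumed compatible with the order). $\mathrm{Gr}_{\mathcal{K}}(n,2n)\subseteq\mathcal{K}^{\binom{[2n]}{n}}$ is the set of vectors of maximal minors $(\det M(C))_{C\in\binom{[2n]}{n}}$ of matrices $M\in\mathcal{K}^{n\times 2n}$. The affine flag variety $\mathrm{Fl}_{\mathcal{K}}(n)\subseteq\mathcal{K}^{2^{[n]}}$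 consists of the $(q_S)_{S\subseteq[n]}$ for which there is a complete flag $\{0\}=L_0\subset L_1\subset\cdots\subset L_n=\mathcal{K}^n$ ($\dim L_k=k$) and nonzero scalars $c_k$ with $(q_S)_{|S|=k}=c_k\cdot$(Plücker vector of $L_k$) for each $k=0,\dots,n$; the Plücker vector of $L_k$ is $(\det M_k(S))_{|S|=k}$ for a $k\times n$ matrix $M_k$ with row span $L_k$. $\mathrm{SUBMOD}_n$: submodular functions $F:2^{[n]}\to\mathbb{R}$, i.e. $F(S\cap T)+F(S\cup T)\le F(S)+F(T)$. $\mathcal{L}_n=\{p\in\mathbb{R}^{\binom{[2n]}{n}} : p(C)=p(D)\text{ whenever } C\cap[n]=D\cap[n]\}$, identified with $\mathbb{R}^{2^{[n]}}$ via $\phi(p)(S)=p(S\cup T)$ for any $T\subseteq\{n+1,\dots,2n\}$ with $|T|=n-|S|$. *)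

(* Defs.v *)
From HB Require Import structures.
From mathcomp Require Import all_boot all_order all_algebra.
From mathcomp Require Import reals.
Set Implicit Arguments. Unset Strict Implicit. Unset Printing Implicit Defensive.
Import Order.TTheory GRing.Theory Num.Theory.
Local Open Scope ring_scope.

Section Valuation.
Variables (R : realType) (K : fieldType) (val : K -> R).

(* val : K^x -> R is a nonarchimedean valuation (values at 0 are irrelevant) *)
Definition nonarch_valuation : Prop :=
  (forall x y : K, x != 0 -> y != 0 -> val (x * y) = val x + val y) /\
  (forall x y : K, x != 0 -> y != 0 -> x + y != 0 ->
     Num.min (val x) (val y) <= val (x + y)).

Definition nontrivial_val : Prop := exists x : K, x != 0 /\ val x != 0.

Definition value_group (g : R) : Prop := exists x : K, x != 0 /\ val x = g.

Definition has_splitting : Prop :=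
  exists phi : R -> K,
    (forall g, value_group g -> phi g != 0 /\ val (phi g) = g) /\
    (forall g h, value_group g -> value_group h -> phi (g + h) = phi g * phi h).

Definition in_val_ring (x : K) : Prop := x = 0 \/ 0 <= val x.
Definition in_max_ideal (x : K) : Prop := x = 0 \/ 0 < val x.

(* the residue field O/m is infinite: an injection nat -> O/m *)
Definition infinite_residue_field : Prop :=
  exists f : nat -> K, (forall i, in_val_ring (f i)) /\
    (forall i j, i <> j -> ~ in_max_ideal (f i - f j)).

Definition nu (x : K) : R := - val x.

Definition nu_set (I : Type) (X : (I -> K) -> Prop) (p : I -> R) : Prop :=
  exists x : I -> K, X x /\ (forall i, x i != 0) /\ (forall i, p i = nu (x i)).

Definition eucl_closure (I : finType) (A : (I -> R) -> Prop) (p : I -> R) : Prop :=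
  forall eps : R, 0 < eps -> exists a, A a /\ forall i, `|p i - a i| < eps.

Definition trop (I : finType) (X : (I -> K) -> Prop) : (I -> R) -> Prop :=
  eucl_closure (nu_set X).

Definition alg_closed : Prop := GRing.closed_field_axiom K.

Definition real_closed_compat : Prop :=
  exists (F : rcfType) (f : {rmorphism K -> F}), bijective f /\
    forall x y : K, x != 0 -> y != 0 -> `|f x| <= `|f y| -> val y <= val x.

End Valuation.

Section Plucker.
Variable K : fieldType.

(* the j-th element (in increasing order) of a k-subset S of 'I_m *)
Definition col_of k m (S : {set 'I_m}) (e : #|S| = k) (j : 'I_k) : 'I_m :=
  enum_val (cast_ord (esym e) j).

Definition pminor k m (M : 'M[K]_(k, m)) (S : {set 'I_m}) : K :=
  match #|S| =P k with
  | ReflectT e => \det (colsub (col_of e) M)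
  | ReflectF _ => 0
  end.

Definition ksub m k := {C : {set 'I_m} | #|C| == k}.

Definition in_Gr n (x : ksub (n + n) n -> K) : Prop :=
  exists M : 'M[K]_(n, n + n), forall C : ksub (n + n) n, x C = pminor M (val C).

(* Fl_K(n) inside K^(2^[n]): L_k = row span of M k (rank k, nested) *)
Definition in_Fl n (q : {set 'I_n} -> K) : Prop :=
  exists (M : forall k : nat, 'M[K]_(k, n)) (c : nat -> K),
    (forall k, (k <= n)%N -> \rank (M k) = k) /\
    (forall k, (k < n)%N -> (M k <= M k.+1)%MS) /\
    (forall k, (k <= n)%N -> c k != 0) /\
    (forall S : {set 'I_n}, q S = c #|S| * pminor (M #|S|) S).

End Plucker.

Section Trop.
Variable R : realType.

Definition low n (C : {set 'I_(n + n)}) : {set 'I_n} :=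
  [set i : 'I_n | lshift n i \in C].

Definition in_Ln n (p : ksub (n + n) n -> R) : Prop :=
  forall C D : ksub (n + n) n, low (val C) = low (val D) -> p C = p D.

Definition phi_graph n (p : ksub (n + n) n -> R) (F : {set 'I_n} -> R) : Prop :=
  forall C : ksub (n + n) n, F (low (val C)) = p C.

Definition submodular n (F : {set 'I_n} -> R) : Prop :=
  forall S T : {set 'I_n}, F (S :&: T) + F (S :|: T) <= F S + F T.

End Trop.

(* Main.v *)
(* From the Grassmannian to the flag variety: normalise the n x 2n matrix to
   [A | I].  The minor on the columns S + {k+1, ..., n}' with |S| = k is the
   minor of the first k rows of A on S, so these minors are the Pluecker
   coordinates of the flag of the row spans of the first k rows of A.
   Submodularity is the three-term Pluecker relation, where membership in L_n
   makes the two right-hand terms equal.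

   Conversely, represent the flag by an upper triangular A, with minors D(S) of
   its first |S| rows.  Submodularity of -val D implies that, on the columns S,
   every row of A is a combination of the first |S| rows with coefficients in
   the valuation ring.  Hence for an n x n matrix B with residually generic
   entries the minor of [A | B] on S + T' is D(S) times a unit.

   For the closures, let G in nu(Fl) be close to F.  The value group is dense,
   so for some small positive g in it the function G(S) - g |S|^2 is still in
   nu(Fl) and is submodular; the first part applies to it.  *)

Require Import Defs.
From HB Require Import structures.
From mathcomp Require Import all_boot all_order all_algebra.
From mathcomp Require Import reals.
From mathcomp Require boolp.
From mathcomp Require Import fingroup perm.
From mathcomp Require Import ring lra zify.
Set Implicit Arguments. Unset Strict Implicit. Unset Printing Implicit Defensive.
Import Order.TTheory GRing.Theory Num.Theory.
Local Open Scope ring_scope.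

(** * Minors on the leading rows of a list of columns *)

Section LeadingMinors.
Variable K : fieldType.
Implicit Types (l : seq (nat -> K)) (x : nat -> K).

(* A column is a function of the row index, and ldet l is the minor of the
   columns l on the first (size l) rows. *)
Definition lmat m l : 'M[K]_m := \matrix_(i < m, j < m) nth (fun=> 0) l j i.
Definition ldet l : K := \det (lmat (size l) l).
(* The coefficient of x i in ldet (rcons l x). *)
Definition lcof l i : K :=
  if insub i is Some i' then cofactor (lmat (size l).+1 (rcons l (fun=> 0))) i' ord_max
  else 0.
Definition unitcol (k i : nat) : K := (i == k)%:R.

Lemma ldet_rcons l x : ldet (rcons l x) = \sum_(i < (size l).+1) x i * lcof l i.
Proof.
rewrite /ldet size_rcons (expand_det_col _ ord_max); apply: eq_bigr => i _.
rewrite /lmat mxE nth_rcons ltnn eqxx; congr (_ * _).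
rewrite /lcof valK /cofactor; congr (_ * \det _).
by apply/matrixP => r c; rewrite !mxE !nth_rcons lift_max ltn_ord.
Qed.

Lemma lcof_size l : lcof l (size l) = ldet l.
Proof.
rewrite /lcof (valK (@ord_max (size l))) /cofactor addnn -signr_odd odd_double mul1r.
congr (\det _); apply/matrixP => r c; rewrite !mxE nth_rcons lift_max ltn_ord.
congr (nth _ _ _ _) => /=.
by rewrite /bump leqNgt ltn_ord.
Qed.

Lemma ldet_rcons_unitcol l : ldet (rcons l (unitcol (size l))) = ldet l.
Proof.
rewrite ldet_rcons big_ord_recr /= lcof_size /unitcol eqxx mul1r big1 ?add0r //.
by move=> i _; rewrite ltn_eqF ?mul0r ?ltn_ord.
Qed.

(** Each appended unit column has a 1 in the new corner and zeros above it, so the size grows while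
    the minor stays the same. For [[A | I]] this turns minors on suitable columns into leading
    minors of A. *)
Lemma ldet_cat_unitcol l r : ldet (l ++ map unitcol (iota (size l) r)) = ldet l.
Proof.
elim: r l => [|r IH] l /=; first by rewrite cats0.
by rewrite -cat_rcons -(size_rcons l (unitcol (size l))) IH ldet_rcons_unitcol.
Qed.

Lemma ldet_perm (T : eqType) (f : T -> nat -> K) (s t : seq T) :
  perm_eq s t -> exists b : bool, ldet (map f s) = (-1) ^+ b * ldet (map f t).
Proof.
move=> st; have := st => /(@tuple_permP _ _ _ (in_tuple t))[p sE].
exists (odd_perm p); rewrite /ldet !size_map (perm_size st).
suff -> : lmat (size t) (map f s) = col_perm p (lmat (size t) (map f t)).
  by rewrite col_permE det_mulmx det_perm odd_permV mulrC.
apply/matrixP => i j; rewrite !mxE sE /=.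
have x0 : T by case: (t) j => [[]|x0].
rewrite -map_comp (nth_map j) ?size_enum_ord // nth_ord_enum /=.
by rewrite (nth_map x0) // (tnth_nth x0).
Qed.

(** Block elimination: the hypothesis writes the lower rows of the columns [l] through the upper
    ones with coefficients [V]. Subtracting these combinations clears the lower left block, and the
    second factor is the determinant of the Schur complement. *)
Lemma ldet_cat l l2 (V : nat -> nat -> K) :
  (forall k, (k < size l)%N -> forall i, (i < size l2)%N ->
     nth (fun=> 0) l k (size l + i)%N
       = \sum_(t < size l) V i t * nth (fun=> 0) l k t) ->
  ldet (l ++ l2) = ldet l *
    ldet [seq (fun i => x (size l + i)%N - \sum_(t < size l) V i t * x t) | x <- l2].
Proof.
move=> Vl; rewrite /ldet size_cat size_map; set m := size l in Vl *; set r := size l2 in Vl *.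
pose Q : 'M_(m + r) := block_mx 1%:M 0 (- \matrix_(i < r, t < m) V i t) 1%:M.
have detQ : \det Q = 1 by rewrite det_lblock !det1 mulr1.
rewrite -[LHS]mul1r -detQ -det_mulmx.
pose UR := \matrix_(i < m, j < r) nth (fun=> 0) l2 j i.
set M2 := lmat r _.
have -> : Q *m lmat (m + r) (l ++ l2) = block_mx (lmat m l) UR 0 M2.
  have -> : lmat (m + r) (l ++ l2) = block_mx (lmat m l) UR
     (\matrix_(i < r, j < m) nth (fun=> 0) l j (m + i)%N)
     (\matrix_(i < r, j < r) nth (fun=> 0) l2 j (m + i)%N).
    apply/matrixP => i j; rewrite !mxE.
    case: (split_ordP i) => i' -> ; rewrite !mxE; case: (split_ordP j) => j' ->;
      rewrite ?mxE /= nth_cat ?ltn_ord -?/m //.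
    - by rewrite ltnNge leq_addr addKn.
    - by rewrite ltnNge leq_addr addKn.
  rewrite mulmx_block !mul1mx !mul0mx !addr0; congr block_mx.
    apply/matrixP => i j; rewrite mulNmx !mxE Vl // addrC.
    by under [X in _ - X]eq_bigr do rewrite !mxE; rewrite subrr.
  apply/matrixP => i j; rewrite mulNmx !mxE addrC (nth_map (fun=> 0)) //.
  by under [X in _ - X]eq_bigr do rewrite !mxE.
by rewrite det_ublock.
Qed.

End LeadingMinors.

(** * Linear systems with a nonzero minor *)

Section Solving.
Variable K : fieldType.
Implicit Types (l : seq (nat -> K)) (v : nat -> K).

Lemma ldet_solve l (g : nat -> K) : ldet l != 0 ->
  exists v, forall k, (k < size l)%N ->
    \sum_(t < size l) v t * nth (fun=> 0) l k t = g k.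
Proof.
rewrite -unitfE => ul.
pose w := (\row_(k < size l) g k) *m invmx (lmat (size l) l).
exists (fun t => if insub t is Some t' then w 0 t' else 0) => k ltk.
have : (w *m lmat (size l) l) 0 (Ordinal ltk) = g k by rewrite mulmxKV // mxE.
by rewrite mxE => <-; apply: eq_bigr => t _; rewrite valK !mxE.
Qed.

Lemma ldet_inj l v : ldet l != 0 ->
  (forall k, (k < size l)%N -> \sum_(t < size l) v t * nth (fun=> 0) l k t = 0) ->
  forall t, (t < size l)%N -> v t = 0.
Proof.
rewrite -unitfE => ul v0 t ltt.
have : (\row_(k < size l) v k) *m lmat (size l) l = 0.
  by apply/rowP => k; rewrite !mxE -[RHS](v0 k) //; apply: eq_bigr => s _; rewrite !mxE.
move/(congr1 (mulmx^~ (invmx (lmat (size l) l)))); rewrite mulmxK // mul0mx.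
by move/rowP/(_ (Ordinal ltt)); rewrite !mxE.
Qed.

Variables (n : nat) (a : 'I_n -> nat -> K).
Definition minorS (S : {set 'I_n}) : K := ldet (map a (enum S)).

Lemma minorS_solve (S : {set 'I_n}) (g : 'I_n -> K) : minorS S != 0 ->
  exists v : nat -> K, forall j, j \in S -> \sum_(t < #|S|) v t * a j t = g j.
Proof.
(* Transports [g] to positions in [enum S]; [ohead] avoids a default element, as ['I_n] may be
   empty. *)
move=> DS; pose h k := if ohead (drop k (enum S)) is Some j then g j else 0.
have [v vP] := ldet_solve h DS; exists v => j jS.
have := vP (index j (enum S)); rewrite size_map -cardE.
rewrite {1}cardE index_mem mem_enum => /(_ jS).
rewrite (nth_map j) ?index_mem ?mem_enum // nth_index ?mem_enum // => ->.
by rewrite /h (drop_nth j) ?index_mem ?mem_enum // nth_index ?mem_enum.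
Qed.

Lemma minorS_inj (S : {set 'I_n}) v : minorS S != 0 ->
  (forall j, j \in S -> \sum_(t < #|S|) v t * a j t = 0) ->
  forall t, (t < #|S|)%N -> v t = 0.
Proof.
move=> DS v0 t; have := @ldet_inj _ v DS; rewrite size_map -cardE; apply=> k ltk.
have j : 'I_n by move: ltk; rewrite cardE; case: (enum S).
rewrite (nth_map j) -?cardE //; apply: v0.
by rewrite -mem_enum mem_nth // -cardE.
Qed.

(** A Schur complement of size one: the last factor is the error at [c] when row [#|S|] is
    extrapolated by the relation valid on [S]. The sign comes from moving [c] to the end of the
    increasing enumeration. *)
Lemma minorS_set1U (S : {set 'I_n}) c v : c \notin S ->
  (forall j, j \in S -> \sum_(t < #|S|) v t * a j t = a j #|S|) ->
  exists b : bool, minorS (c |: S)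
     = (-1) ^+ b * (minorS S * (a c #|S| - \sum_(t < #|S|) v t * a c t)).
Proof.
move=> cS vS.
have p : perm_eq (enum (c |: S)) (rcons (enum S) c).
  apply: uniq_perm; rewrite ?enum_uniq ?rcons_uniq ?mem_enum ?cS ?enum_uniq // => j.
  by rewrite mem_rcons in_cons !mem_enum !inE.
have [b Eb] := ldet_perm a p; exists b; rewrite /minorS Eb map_rcons -cats1.
rewrite (@ldet_cat _ _ _ (fun _ => v)); last first.
  move=> k; rewrite size_map /= => ltk [|//] _; rewrite addn0.
  have j : 'I_n by move: ltk; case: (enum S).
  rewrite (nth_map j) // -cardE vS //.
  by rewrite -mem_enum mem_nth.
by rewrite [X in _ * (_ * X)]/ldet /= det_mx11 mxE /= addn0 size_map -cardE.
Qed.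

End Solving.

(** * Pluecker coordinates as leading minors *)

Section Minors.
Variable K : fieldType.

Lemma pminor_ldet k m (M : 'M[K]_(k, m)) (a : 'I_m -> nat -> K) (C : {set 'I_m}) :
  (forall i j, M i j = a j i) -> #|C| = k -> pminor M C = ldet (map a (enum C)).
Proof.
move=> Ma eC; rewrite /pminor; case: (#|C| =P k) => [e|//].
rewrite /ldet size_map -cardE; case: _ / e {eC} M Ma => M Ma.
congr (\det _); apply/matrixP => i j; rewrite !mxE Ma.
have x0 : 'I_m by exact: (enum_val j).
by rewrite (nth_map x0) -?cardE // /col_of cast_ord_id (enum_val_nth x0).
Qed.

Lemma pminor_mul k m (Q : 'M[K]_k) (M : 'M[K]_(k, m)) (C : {set 'I_m}) :
  pminor (Q *m M) C = \det Q * pminor M C.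
Proof.
rewrite /pminor; case: (#|C| =P k) => [e|_]; last by rewrite mulr0.
by rewrite -mulmx_colsub det_mulmx.
Qed.

Lemma pminor_neq0_card k m (M : 'M[K]_(k, m)) (C : {set 'I_m}) :
  pminor M C != 0 -> #|C| = k.
Proof. by rewrite /pminor; case: (#|C| =P k) => // _; rewrite eqxx. Qed.

End Minors.

(** * Subsets of the 2n columns as pairs of subsets of [n] *)

Section IndexSets.
Variable n : nat.

Definition high (C : {set 'I_(n + n)}) : {set 'I_n} := [set i | rshift n i \in C].
Definition join (S T : {set 'I_n}) : {set 'I_(n + n)} :=
  [set j | match split j with inl s => s \in S | inr t => t \in T end].

Lemma low_join S T : low (join S T) = S.
Proof.
apply/setP => i; rewrite !inE; case: (split_ordP (lshift n i)) => j /eqP;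
  by rewrite ?eq_lshift ?eq_lrshift // => /eqP->.
Qed.

Lemma high_join S T : high (join S T) = T.
Proof.
apply/setP => i; rewrite !inE; case: (split_ordP (rshift n i)) => j /eqP;
  by rewrite ?eq_rshift ?eq_rlshift // => /eqP->.
Qed.

(** Left columns precede right ones in the increasing order, so no sign appears when the columns of
    a minor of [[A | B]] are split into the two groups. *)
Lemma enum_low_high (C : {set 'I_(n + n)}) :
  enum C = map (lshift n) (enum (low C)) ++ map (@rshift n n) (enum (high C)).
Proof.
have E : enum 'I_(n + n) = map (lshift n) (enum 'I_n) ++ map (@rshift n n) (enum 'I_n).
  apply: (inj_map (@ord_inj (n + n))); rewrite map_cat -2!map_comp.
  rewrite [LHS](fintype.val_enum_ord (n + n)) iotaD -(fintype.val_enum_ord n).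
  congr (_ ++ _).
  rewrite add0n -{1}[n in LHS]addn0 iotaDl -(fintype.val_enum_ord n) -map_comp.
  by apply: eq_map.
rewrite {1}/enum_mem -enumT E filter_cat !filter_map.
rewrite [enum (low C)]/enum_mem [enum (high C)]/enum_mem -!enumT.
by congr (_ ++ _); congr map; rewrite map_id; apply: eq_filter => i; rewrite /= !inE.
Qed.

Lemma card_low_high (C : {set 'I_(n + n)}) : (#|low C| + #|high C|)%N = #|C|.
Proof. by rewrite [RHS]cardE enum_low_high size_cat !size_map -!cardE. Qed.

Definition upto k : {set 'I_n} := [set j : 'I_n | (j < k)%N].
Definition from k : {set 'I_n} := [set j : 'I_n | (k <= j)%N].

Lemma val_enum_set (p : pred nat) :
  map val (enum [set j : 'I_n | p j]) = filter p (iota 0 n).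
Proof.
rewrite {1}/enum_mem -enumT -(fintype.val_enum_ord n) filter_map.
by congr map; apply: eq_filter => i; rewrite !inE.
Qed.

Lemma val_enum_upto k : (k <= n)%N -> map val (enum (upto k)) = iota 0 k.
Proof.
move=> kn; rewrite (val_enum_set (fun j => (j < k)%N)).
rewrite -{1}(subnKC kn) iotaD filter_cat.
rewrite (@eq_in_filter _ _ xpredT) ?filter_predT; last first.
  by move=> i; rewrite mem_iota add0n.
rewrite (@eq_in_filter _ _ xpred0 (iota _ _)) ?filter_pred0 ?cats0 //.
by move=> i; rewrite mem_iota add0n => /andP[ki _]; rewrite ltnNge ki.
Qed.

Lemma val_enum_from k : (k <= n)%N -> map val (enum (from k)) = iota k (n - k).
Proof.
move=> kn; rewrite (val_enum_set (fun j => (k <= j)%N)).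
rewrite -{1}(subnKC kn) iotaD filter_cat.
rewrite (@eq_in_filter _ _ xpred0) ?filter_pred0; last first.
  by move=> i; rewrite mem_iota add0n => /andP[_ ik]; rewrite leqNgt ik.
rewrite (@eq_in_filter _ _ xpredT (iota _ _)) ?filter_predT //.
by move=> i; rewrite mem_iota add0n => /andP[ki _]; rewrite ki.
Qed.

Lemma card_upto k : (k <= n)%N -> #|upto k| = k.
Proof. by move=> kn; rewrite cardE -(size_map val) val_enum_upto // size_iota. Qed.

Lemma card_from k : (k <= n)%N -> #|from k| = (n - k)%N.
Proof. by move=> kn; rewrite cardE -(size_map val) val_enum_from // size_iota. Qed.

End IndexSets.

(** * Valuation ring, maximal ideal and residually generic columns *)

Section ValuationRing.
Variables (R : realType) (K : fieldType) (val : K -> R).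
Hypothesis hv : nonarch_valuation val.

Local Notation O := (in_val_ring val).
Local Notation mm := (in_max_ideal val).
Definition val_unit (x : K) : Prop := x != 0 /\ val x = 0.

Lemma valuM x y : x != 0 -> y != 0 -> val (x * y) = val x + val y.
Proof. exact: hv.1. Qed.

Lemma valu1 : val 1 = 0.
Proof. by have := valuM (oner_neq0 _) (oner_neq0 _); rewrite mulr1; lra. Qed.

Lemma valuN x : val (- x) = val x.
Proof.
have [->|x0] := eqVneq x 0; first by rewrite oppr0.
have n1 : (-1 : K) != 0 by rewrite oppr_eq0 oner_neq0.
have := valuM n1 n1; rewrite mulrNN mulr1 valu1 => h.
by rewrite -mulN1r valuM //; lra.
Qed.

Lemma valuV x : x != 0 -> val x^-1 = - val x.
Proof.
move=> x0; have := valuM x0 (_ : x^-1 != 0); rewrite invr_eq0 => /(_ x0).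
by rewrite mulfV // valu1; lra.
Qed.

Lemma valuX x k : x != 0 -> val (x ^+ k) = val x *+ k.
Proof.
move=> x0; elim: k => [|k IH]; first by rewrite expr0 valu1 mulr0n.
by rewrite exprS valuM ?expf_neq0 // IH mulrS.
Qed.

Lemma val_sign (b : bool) x : val ((-1) ^+ b * x) = val x.
Proof. by case: b; rewrite ?expr1 ?expr0 ?mul1r // mulN1r valuN. Qed.

Lemma valring0 : O 0. Proof. by left. Qed.
Lemma valring1 : O 1. Proof. by right; rewrite valu1. Qed.

Lemma valringM x y : O x -> O y -> O (x * y).
Proof.
have [-> _ _|x0] := eqVneq x 0; first by rewrite mul0r; left.
have [-> _ _|y0] := eqVneq y 0; first by rewrite mulr0; left.
move=> [/eqP|vx]; first by rewrite (negPf x0).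
move=> [/eqP|vy]; first by rewrite (negPf y0).
by right; rewrite valuM // addr_ge0.
Qed.

Lemma valringN x : O x -> O (- x).
Proof. by move=> [->|vx]; [left; rewrite oppr0|right; rewrite valuN]. Qed.

Lemma valringD x y : O x -> O y -> O (x + y).
Proof.
have [-> _|x0] := eqVneq x 0; first by rewrite add0r.
have [-> //|y0] := eqVneq y 0; first by rewrite addr0.
have [-> _ _|s0] := eqVneq (x + y) 0; first by left.
move=> [/eqP|vx]; first by rewrite (negPf x0).
move=> [/eqP|vy]; first by rewrite (negPf y0).
by right; apply: le_trans (hv.2 _ _ x0 y0 s0); rewrite le_min vx.
Qed.

Lemma valringB x y : O x -> O y -> O (x - y).
Proof. by move=> Ox Oy; apply/valringD/valringN. Qed.

Lemma valring_sum (I : Type) (r : seq I) (P : pred I) (F : I -> K) :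
  (forall i, P i -> O (F i)) -> O (\sum_(i <- r | P i) F i).
Proof. by move=> OF; apply: big_ind OF; [exact: valring0 | exact: valringD]. Qed.

Lemma valring_prod (I : Type) (r : seq I) (P : pred I) (F : I -> K) :
  (forall i, P i -> O (F i)) -> O (\prod_(i <- r | P i) F i).
Proof. by move=> OF; apply: big_ind OF; [exact: valring1 | exact: valringM]. Qed.

Lemma valring_sign (b : bool) : O ((-1) ^+ b).
Proof. by right; rewrite -[_ ^+ _]mulr1 val_sign valu1. Qed.

Lemma valringX x k : O x -> O (x ^+ k).
Proof. by move=> Ox; elim: k => [|k IH]; [exact: valring1|rewrite exprS; apply: valringM]. Qed.

Lemma valring_det m (A : 'M[K]_m) : (forall i j, O (A i j)) -> O (\det A).
Proof.
move=> OA; apply: valring_sum => s _; apply: valringM; first exact: valring_sign.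
by apply: valring_prod.
Qed.

Lemma val_unit_ring x : val_unit x -> O x.
Proof. by move=> [_ vx]; right; rewrite vx. Qed.

Lemma val_unitM x y : val_unit x -> val_unit y -> val_unit (x * y).
Proof. by move=> [x0 vx] [y0 vy]; split; rewrite ?mulf_neq0 // valuM // vx vy addr0. Qed.


Lemma val_unitP x : O x -> ~ mm x -> val_unit x.
Proof.
move=> Ox nm; have x0 : x != 0 by apply/eqP => x0; apply: nm; left.
split=> //; case: Ox => [/eqP|vx]; first by rewrite (negPf x0).
apply/eqP; rewrite eq_le vx andbT leNgt; apply/negP => h; apply: nm.
by right.
Qed.

Lemma val_unit_not_max x : val_unit x -> ~ mm x.
Proof. by move=> [/eqP x0 vx] [//|]; rewrite vx ltxx. Qed.

Lemma maxidealN x : mm x -> mm (- x).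
Proof. by move=> [->|vx]; [left; rewrite oppr0|right; rewrite valuN]. Qed.

Lemma maxidealM x y : O x -> mm y -> mm (x * y).
Proof.
have [-> _ _|x0] := eqVneq x 0; first by rewrite mul0r; left.
have [-> _ _|y0] := eqVneq y 0; first by rewrite mulr0; left.
move=> [/eqP|vx]; first by rewrite (negPf x0).
move=> [/eqP|vy]; first by rewrite (negPf y0).
by right; rewrite valuM // ltr_wpDl.
Qed.

Lemma maxidealD x y : mm x -> mm y -> mm (x + y).
Proof.
have [-> _|x0] := eqVneq x 0; first by rewrite add0r.
have [-> //|y0] := eqVneq y 0; first by rewrite addr0.
have [-> _ _|s0] := eqVneq (x + y) 0; first by left.
move=> [/eqP|vx]; first by rewrite (negPf x0).
move=> [/eqP|vy]; first by rewrite (negPf y0).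
by right; apply: lt_le_trans (hv.2 _ _ x0 y0 s0); rewrite lt_min vx.
Qed.

Lemma maxideal_ring x : mm x -> O x.
Proof. by move=> [->|vx]; [left|right; exact: ltW]. Qed.

Lemma val_unitD x y : val_unit x -> mm y -> val_unit (x + y).
Proof.
move=> ux my; apply: val_unitP.
  by apply: valringD; [exact: val_unit_ring|exact: maxideal_ring].
move=> mxy; apply: (val_unit_not_max ux).
by rewrite -(addrK y x); apply/maxidealD/maxidealN.
Qed.

Lemma maxideal_dec x : mm x \/ ~ mm x.
Proof.
have [->|x0] := eqVneq x 0; first by left; left.
have [vx|vx] := ltP 0 (val x); first by left; right.
by right => -[/eqP|]; rewrite ?(negPf x0) // ltNge vx.
Qed.

Hypothesis hr : infinite_residue_field val.

(* A residually nonzero polynomial has finitely many residual roots, so it is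
   a unit at all but finitely many of the given representatives. *)
Lemma residual_roots_finite (f : nat -> K) :
  (forall i, O (f i)) -> (forall i j, i <> j -> ~ mm (f i - f j)) ->
  forall p : {poly K}, (forall i, O p`_i) -> (exists i, val_unit p`_i) ->
  exists N, forall i, (N <= i)%N -> val_unit p.[f i].
Proof.
move=> Of df p; have [d] := ubnP (size p); elim: d p => // d IH p szp Op [i0 ui0].
have Oev (q : {poly K}) i : (forall j, O q`_j) -> O q.[f i].
  move=> Oq; rewrite horner_coef; apply: valring_sum => j _.
  by apply: valringM => //; apply: valringX.
have [[i mi]|nomi] : (exists i, mm p.[f i]) \/ ~ (exists i, mm p.[f i]).
  exact: boolp.EM.
  (* Divide by the factor of a residual root [f i]: [p = q (X - f i) + p(f i)] with remainder in the
     maximal ideal, and induct on [q]. *)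
  have /factor_theorem[q qE] : root (p - p.[f i]%:P) (f i).
    by rewrite rootE !hornerE subrr.
  have pE : p = q * ('X - (f i)%:P) + p.[f i]%:P by rewrite -qE subrK.
  have coefE k : p`_k = (if k == 0%N then 0 else q`_k.-1) - q`_k * f i
                  + (if k == 0%N then p.[f i] else 0).
    by rewrite {1}pE mulrBr coefD coefB coefMX coefMC coefC.
  (* Read from the top coefficient downwards, this recursion shows that [q] is integral. *)
  have qrec k : q`_k = p`_k.+1 + q`_k.+1 * f i by rewrite coefE /= addr0 subrK.
  have Oq : forall e k, (size q <= k + e)%N -> O q`_k.
    elim=> [|e IHe] k; first by rewrite addn0 => /leq_sizeP ->; [left|].
    by rewrite addnS -addSn => /IHe Oq; rewrite qrec; apply/valringD/valringM.
  have {}Oq k : O q`_k by apply: (Oq (size q)); rewrite leq_addl.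
  (* If all coefficients of [q] were in the maximal ideal, all those of [p] would be too. *)
  have [k uk] : exists k, val_unit q`_k.
    apply: boolp.contrapT => nu; apply: (val_unit_not_max ui0).
    have mq k : mm q`_k.
      by have [//|nm] := maxideal_dec q`_k; case: nu; exists k; apply: val_unitP.
    rewrite coefE; apply: maxidealD; last by case: eqP => _; [|left].
    apply: maxidealD; first by case: eqP => _; [left|].
    by rewrite mulrC; apply/maxidealN/maxidealM.
  have q0 : q != 0 by apply/eqP => q0; move: uk.1; rewrite q0 coef0 eqxx.
  have [|N NP] := IH q _ Oq (ex_intro _ k uk).
    move: szp; rewrite pE size_polyDl ?size_Mmonic ?monicXsubC // size_XsubC addn2 //=.
    by rewrite ltnS (leq_trans (size_polyC_leq1 _)) // size_poly_gt0.
  (* Indices must also exceed [i], so that [f j - f i] is a unit. *)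
  exists (maxn N i.+1) => j; rewrite geq_max => /andP[Nj ij].
  rewrite pE !hornerE; apply: val_unitD => //; apply: val_unitM; first exact: NP.
  by apply: val_unitP; [exact: valringB|apply: df => ji; rewrite ji ltnn in ij].
exists 0%N => i _; apply: val_unitP; first exact: Oev.
by move=> mi; apply: nomi; exists i.
Qed.

Definition integral_cols (l : seq (nat -> K)) : Prop :=
  forall k, (k < size l)%N -> forall t, O (nth (fun=> 0) l k t).

Lemma valring_lcof l i : integral_cols l -> O (lcof l i).
Proof.
move=> Ol; rewrite /lcof; case: insubP => [i' _ _|_]; last by left.
apply: valringM.
  by rewrite -signr_odd; apply: valring_sign.
apply: valring_det => r c; rewrite !mxE nth_rcons.
case: ltnP => [/Ol //|_]; by case: eqP => _; left.
Qed.

(* The new column is (1, t, t^2, ...): the minor is then a polynomial in t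
   whose leading coefficient is the previous minor, hence a unit. *)
Lemma generic_column (I : finType) (L : I -> seq (nat -> K)) :
  (forall s, integral_cols (L s)) -> (forall s, val_unit (ldet (L s))) ->
  exists b : nat -> K, (forall t, O (b t)) /\
    forall s, val_unit (ldet (rcons (L s) b)).
Proof.
move=> OL uL; have [f [Of df]] := hr.
have /fin_all_exists[N NP] s : exists N, forall i, (N <= i)%N ->
    val_unit (ldet (rcons (L s) (fun t => f i ^+ t))).
  pose p := \poly_(t < (size (L s)).+1) lcof (L s) t.
  have [t||N NP] := @residual_roots_finite f Of df p.
  - by rewrite coef_poly; case: ifP => _; [apply: valring_lcof; apply: OL|left].
  - by exists (size (L s)); rewrite coef_poly leqnn lcof_size.
  exists N => i /NP; rewrite horner_poly ldet_rcons.
  by under eq_bigr do rewrite mulrC.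
exists (fun t => f (\max_s N s)%N ^+ t); split => [t|s]; first exact: valringX.
exact/NP/leq_bigmax.
Qed.

(** Columns are added one at a time. Each step doubles the family, keeping every list both with and
    without the new column, so that in the end every subset of [B], encoded by a mask [m], is
    covered. *)
Lemma generic_columns (I : finType) (L : I -> seq (nat -> K)) r :
  (forall s, integral_cols (L s)) -> (forall s, val_unit (ldet (L s))) ->
  exists B : seq (nat -> K), size B = r /\
    forall s m, val_unit (ldet (L s ++ mask m B)).
Proof.
elim: r I L => [|r IH] I L OL uL.
  by exists [::]; split=> // s m; rewrite mask0 cats0.
have [b [Ob ub]] := generic_column OL uL.
pose L' (s : I + I) := match s with inl s => L s | inr s => rcons (L s) b end.
have [|s|B [sB uB]] := IH _ L'.
- case=> s /=; first exact: OL.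
  move=> k; rewrite size_rcons ltnS nth_rcons; by case: ltngtP => // lt _; apply: OL.
- by case: s => s /=.
exists (b :: B); split=> [/=|s [|[] m] /=]; first by rewrite sB.
- by rewrite cats0.
- by have := uB (inr s) m; rewrite /= cat_rcons.
- exact: (uB (inl s) m).
Qed.

End ValuationRing.

(** * Integral row coordinates from submodularity *)

Section Integrality.
Variables (R : realType) (K : fieldType) (val : K -> R).
Hypothesis hv : nonarch_valuation val.
Variables (n : nat) (a : 'I_n -> nat -> K).
Hypothesis Dneq0 : forall S, minorS a S != 0.
Hypothesis Dsub : forall (S : {set 'I_n}) i c, i \notin S -> c \notin S -> i != c ->
  val (minorS a (i |: S)) + val (minorS a (c |: S))
    <= val (minorS a S) + val (minorS a (c |: (i |: S))).
Hypothesis a_upper : forall (j : 'I_n) i, (j < i)%N -> a j i = 0.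

Local Notation O := (in_val_ring val).

(* Exchange i in S for one of the first k columns c not in S, moving S towards
   the first k columns, where A vanishes in row b.  The two coordinate vectors differ by a multiple of
   the vector expressing the dependency of rows 1, ..., k on S - i, whose
   coordinates are integral because they concern a closer pair of rows, and the
   multiplier is a ratio of minors that submodularity makes integral. *)
Lemma row_coord_integral k r b (S : {set 'I_n}) (v : nat -> K) :
  (r < k)%N -> (k <= b)%N -> #|S| = k ->
  (forall j, j \in S -> \sum_(t < k) v t * a j t = a j b) -> O (v r).
Proof.
(* Outer induction on [b - r]; the inner one counts the elements of [S] outside the first [k]
   columns. *)
have [e] := ubnP (b - r)%N; elim: e k r b S v => // e IHe k r b S v ltbr ltrk lekb cS vS.
have [d] := ubnP #|S :\: upto n k|; elim: d S v cS vS => // d IHd S v cS vS ltd.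
(* Base case: row [b] vanishes on the first [k] columns because [k <= b], so [v] is zero. *)
have [sub|/subsetPn[i iS ik]] := boolP (S \subset upto n k).
  have v0 : forall t, (t < #|S|)%N -> v t = 0.
    apply: minorS_inj (Dneq0 S) _ => j jS; rewrite cS vS // a_upper //.
    by have := subsetP sub _ jS; rewrite inE => /leq_trans; apply.
  by rewrite v0 ?cS //; left.
have kn : (k <= n)%N by rewrite -cS -[n in (_ <= n)%N]card_ord max_card.
have [sub|/subsetPn[c ck ncS]] := boolP (upto n k \subset S).
  by move: ik; rewrite (eqP (_ : upto n k == S)) ?iS // eqEcard sub cS card_upto /=.
(* From here on [k] is one less than [#|S|]. *)
case: k ltrk lekb cS vS kn ltd ik ck IHd => // k ltrk lekb cS vS kn ltd ik ck IHd.
have nci : c != i by apply: contraNneq ik => <-.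
pose S' := S :\ i; have ES : S = i |: S' by rewrite setD1K.
have iS' : i \notin S' by rewrite !inE eqxx.
have cS' : c \notin S' by rewrite !inE (negPf ncS) andbF.
have card_S' : #|S'| = k by move: cS; rewrite (cardsD1 i) iS => -[].
have card_cS' : #|c |: S'| = k.+1 by rewrite cardsU1 cS' card_S'.
have [v2 v2S] := minorS_solve (fun j => a j b) (Dneq0 (c |: S')).
rewrite card_cS' in v2S.
have Ov2 : O (v2 r).
  apply: (IHd (c |: S')) => //.
  rewrite -ltnS; apply: leq_trans ltd; rewrite ltnS; apply: proper_card; apply/properP; split.
    apply/subsetP => j; rewrite !inE => /andP[jk /orP[/eqP jc|/andP[_ jS]]].
      by move: ck; rewrite inE -jc (negPf jk).
    by rewrite jk.
  by exists i; move: ik; rewrite !inE ?iS ?eqxx => -> //=; rewrite orbF eq_sym nci.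
have [v1 v1S] := minorS_solve (fun j => a j k) (Dneq0 S').
have [s1 D1] := minorS_set1U cS' (fun j jS => etrans (v1S j jS) (congr1 (a j) (esym card_S'))).
have [v3 v3S] := minorS_solve (fun j => a j k.+1) (Dneq0 S).
have [s3 D3] := minorS_set1U ncS (fun j jS => etrans (v3S j jS) (congr1 (a j) (esym cS))).
rewrite card_S' in v1S D1; rewrite cS in v3S D3.
set r1 := (_ - _) in D1; set r3 := (_ - _) in D3.
have r1_0 : r1 != 0.
  by apply: contraNneq (Dneq0 (c |: S')) => E; rewrite D1 E !mulr0.
have r3_0 : r3 != 0.
  by apply: contraNneq (Dneq0 (c |: S)) => E; rewrite D3 E !mulr0.
(* By [D1] and [D3], submodularity for [S'], [i], [c] reads [val r1 <= val r3]. *)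
have Or31 : O (r3 / r1).
  right; rewrite valuM ?invr_eq0 // valuV //.
  have := Dsub iS' cS' (_ : i != c); rewrite eq_sym => /(_ nci).
  rewrite -ES D1 D3 !val_sign //.
  by rewrite !valuM ?Dneq0 //; lra.
(* The error of [v] at column [c] is an integral multiple of [r3]. If [b = k.+1] it is [r3] itself;
   otherwise the multiplier is the last coordinate of row [b] on [c |: S], integral by the outer
   induction since [b - k.+1 < b - r]. *)
have [u Ou ur] : exists2 u, O u & a c b - \sum_(t < k.+1) v t * a c t = u * r3.
  have [bk|kb] := leqP b k.+1.
    exists 1; first exact: valring1.
    have {}bk : b = k.+1 by apply/anti_leq; rewrite bk.
    rewrite mul1r /r3 bk; congr (_ - _); apply: eq_bigr => t _; congr (_ * _).
    apply/eqP; rewrite -subr_eq0; apply/eqP.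
    apply: (@minorS_inj _ _ a S (fun t => v t - v3 t)); rewrite ?cS // => j jS.
    under eq_bigr do rewrite mulrBl.
    by rewrite sumrB vS // v3S // bk subrr.
  have cU : #|c |: S| = k.+2 by rewrite cardsU1 ncS cS.
  have [u uU] := minorS_solve (fun j => a j b) (Dneq0 (c |: S)).
  rewrite cU in uU; exists (u k.+1).
    apply: (IHe k.+2 k.+1 b (c |: S)) => //; clear -ltbr ltrk kb; lia.
  have vE t : (t < k.+1)%N -> v t = u t + u k.+1 * v3 t.
    move=> ltt; apply/eqP; rewrite -subr_eq0; apply/eqP.
    apply: (@minorS_inj _ _ a S (fun t => v t - (u t + u k.+1 * v3 t)));
      rewrite ?cS // => j jS.
    under eq_bigr do rewrite mulrBl mulrDl -mulrA.
    rewrite sumrB big_split /= -mulr_sumr vS // v3S // -(uU j) ?inE ?jS ?orbT //.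
    by rewrite big_ord_recr /= subrr.
  rewrite -(uU c) ?inE ?eqxx // big_ord_recr /= /r3.
  have -> : \sum_(t < k.+1) v t * a c t =
      \sum_(t < k.+1) u t * a c t + u k.+1 * \sum_(t < k.+1) v3 t * a c t.
    by rewrite mulr_sumr -big_split; apply: eq_bigr => t _; rewrite vE // mulrDl mulrA.
  ring.
(* The combination [w] vanishes on [S'], so it is determined by [w k] and [v1]; evaluation at column
   [c] then gives [w k * r1 = u * r3]. *)
pose w t := v2 t - v t.
have wE t : (t < k)%N -> w t = - (w k * v1 t).
  move=> ltt; apply/eqP; rewrite -addr_eq0; apply/eqP.
  apply: (@minorS_inj _ _ a S' (fun t => w t + w k * v1 t)); rewrite ?card_S' // => j jS.
  under eq_bigr do rewrite mulrDl -mulrA.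
  rewrite big_split /= -mulr_sumr v1S //.
  transitivity (\sum_(t < k.+1) w t * a j t); first by rewrite big_ord_recr.
  under eq_bigr do rewrite mulrBl.
  by rewrite sumrB v2S ?vS ?subrr ?ES ?(setU1r _ jS).
have wk : w k = u * (r3 / r1).
  apply: (mulIf r1_0); rewrite -!mulrA mulVf // mulr1 -ur -(v2S c) ?inE ?eqxx //.
  rewrite -sumrB; under [RHS]eq_bigr do rewrite -mulrBl.
  rewrite big_ord_recr /= -/(w k) /r1.
  have -> : \sum_(t < k) (v2 t - v t) * a c t = - (w k * \sum_(t < k) v1 t * a c t).
    by rewrite mulr_sumr -sumrN; apply: eq_bigr => t _; rewrite -/(w t) wE // mulNr mulrA.
  ring.
have Owk : O (w k) by rewrite wk; apply: valringM.
suff Ow : O (w r) by rewrite -[v r](subKr (v2 r)); apply: valringB.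
have [rk|kr] := ltnP r k; last first.
  by have -> : r = k by apply/anti_leq; rewrite kr andbT.
rewrite wE //; apply: valringN => //; apply: valringM => //.
(* Here [v1] expresses row [k] on [S'], and [k - r < b - r]. *)
by apply: (IHe k r k S') => //; clear -ltbr ltrk lekb rk; lia.
Qed.

End Integrality.

(** * Triangular form of a flag *)

Section Flags.
Variable K : fieldType.

Definition colfun k m (M : 'M[K]_(k, m)) (j : 'I_m) (i : nat) : K :=
  if insub i is Some i' then M i' j else 0.

Lemma colfunE k m (M : 'M[K]_(k, m)) (i : 'I_k) j : colfun M j i = M i j.
Proof. by rewrite /colfun valK. Qed.

Lemma pminor_colfun k m (M : 'M[K]_(k, m)) (C : {set 'I_m}) :
  #|C| = k -> pminor M C = minorS (colfun M) C.
Proof. by move=> cC; apply: pminor_ldet => // i j; rewrite colfunE. Qed.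

Lemma pminor_solve k m (M : 'M[K]_(k, m)) (C : {set 'I_m}) (g : 'I_m -> K) :
  pminor M C != 0 -> exists z : 'rV_k, forall j, j \in C -> (z *m M) 0 j = g j.
Proof.
move=> MC; have cC := pminor_neq0_card MC; move: MC.
rewrite pminor_colfun // => /minorS_solve-/(_ g)[v]; rewrite cC => vP.
exists (\row_t v t) => j /vP <-; rewrite mxE; apply: eq_bigr => t _.
by rewrite mxE colfunE.
Qed.

Lemma minorS_upto n (a : 'I_n -> nat -> K) k : (k <= n)%N ->
  (forall (j : 'I_n) i, (j < i)%N -> a j i = 0) ->
  forall d : nat -> K, (forall j : 'I_n, (j < k)%N -> a j j = d j) ->
  minorS a (upto n k) = \prod_(i < k) d i.
Proof.
move=> kn a_upper d ad.
have E i : (i < k)%N -> exists2 j : 'I_n, val j = i &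
    nth (fun=> 0) (map a (enum (upto n k))) i = a j.
  move=> ltik; have j0 : 'I_n by exists i; apply: leq_trans kn.
  exists (nth j0 (enum (upto n k)) i).
    by rewrite -(nth_map _ 0%N) -?cardE ?card_upto // val_enum_upto // nth_iota.
  by rewrite (nth_map j0) // -cardE card_upto.
rewrite /minorS /ldet size_map -cardE card_upto // -det_tr det_trig.
  apply: eq_bigr => i _; rewrite !mxE; have [j ji ->] := E i (ltn_ord i).
  by rewrite -ji ad // ji.
apply/is_trig_mxP => i j ltij; rewrite !mxE; have [s si ->] := E i (ltn_ord i).
by rewrite a_upper // si.
Qed.

(** Let [L_k] be the row span of [M k]. Row [b], counted from 0, is taken in [L_(b+1)] with zeros in
    its first [b] entries and a prescribed diagonal entry. The first [k] rows lie in [L_k], so their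
    minors are proportional to [q] on sets of size [k]; the diagonal makes the factor the same for
    all [k]. *)
Lemma flag_triangular n (q : {set 'I_n} -> K) : in_Fl q -> (forall S, q S != 0) ->
  exists a : 'I_n -> nat -> K, (forall (j : 'I_n) i, (j < i)%N -> a j i = 0) /\
    forall S, q S = q set0 * minorS a S.
Proof.
move=> [M [c [_ [Mnest [c0 qE]]]]] q0.
have pm0 (S : {set 'I_n}) : pminor (M #|S|) S != 0.
  by have := q0 S; rewrite qE mulf_eq0 negb_or => /andP[].
have Mmono k : (k <= n)%N -> forall i, (i <= k)%N -> (M i <= M k)%MS.
  elim: k => [|k IH] kn i; first by rewrite leqn0 => /eqP->.
  rewrite leq_eqVlt => /orP[/eqP->//|]; rewrite ltnS => ik.
  by apply: submx_trans (Mnest _ kn); apply: IH => //; exact: ltnW.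
(* These ratios telescope: the minor on the first [k] columns becomes [q (upto n k) / q set0], which
   fixes the factor. *)
pose d b := q (upto n b.+1) / q (upto n b).
have /fin_all_exists[u uP] (b : 'I_n) : exists u : 'rV_n,
    (u <= M b.+1)%MS /\ forall j : 'I_n, (j <= b)%N -> u 0 j = if j == b then d b else 0.
  have := pm0 (upto n b.+1); rewrite card_upto // => pmb.
  have [z zP] := pminor_solve (fun j => if j == b then d b else 0) pmb.
  by exists (z *m M b.+1); split=> [|j jb]; [exact: submxMl|apply: zP; rewrite inE].
pose A := \matrix_(b < n, j < n) u b 0 j.
have a_upper (j : 'I_n) i : (j < i)%N -> colfun A j i = 0.
  move=> ji; rewrite /colfun; case: insubP => // b _ bi.
  rewrite mxE (uP b).2 ?bi 1?ltnW //; case: eqP => // jb.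
  by rewrite jb -bi ltnn in ji.
exists (colfun A); split=> // S; set k := #|S|.
have kn : (k <= n)%N by rewrite -[n in (_ <= n)%N]card_ord max_card.
pose Ak := \matrix_(i < k, j < n) colfun A j i.
have /submxP[Q AQ] : (Ak <= M k)%MS.
  apply/row_subP => i; pose b := widen_ord kn i.
  have -> : row i Ak = u b.
    by apply/rowP => j; rewrite !mxE -[i : nat]/(b : nat) colfunE mxE.
  exact: submx_trans (uP b).1 (Mmono _ kn _ (ltn_ord i)).
have AkE (T : {set 'I_n}) : #|T| = k -> minorS (colfun A) T = \det Q * (q T / c k).
  move=> cT; rewrite -[LHS](@pminor_ldet _ _ _ Ak) => [|i j|//]; last by rewrite mxE.
  by rewrite AQ pminor_mul qE cT [c k * _]mulrC mulfK // c0.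
have := AkE _ (card_upto kn).
rewrite (@minorS_upto _ _ _ kn a_upper d) => [|j jk]; last first.
  by rewrite colfunE mxE (uP j).2 // eqxx.
have -> : \prod_(i < k) d i = q (upto n k) / q set0.
  elim: k {Ak Q AQ AkE} kn => [|k IH] kn.
    by rewrite big_ord0 (_ : upto n 0 = set0) ?divff //; apply/setP => j; rewrite !inE.
  by rewrite big_ord_recr /= IH ?(ltnW kn) // /d mulrC mulrA divfK.
rewrite AkE //.
have ck := c0 k kn; have qk := q0 (upto n k); have q00 := q0 set0 => E.
apply: (mulfI ck); apply: (mulfI qk).
transitivity (q (upto n k) / q set0 * q set0 * c k * q S); first by rewrite divfK //; ring.
rewrite E; field; exact: ck.
Qed.

End Flags.

(** * From submodular flags to the Grassmannian *)

Section FlagToGrassmannian.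
Variables (R : realType) (K : fieldType) (val : K -> R).
Hypothesis hv : nonarch_valuation val.
Hypothesis hr : infinite_residue_field val.

(* The columns of I (k x k) stacked on top of V. *)
Definition unit_over k (V : nat -> nat -> K) : seq (nat -> K) :=
  mkseq (fun t i => if (i < k)%N then unitcol K t i else V (i - k)%N t) k.

Lemma ldet_unit_over k V : ldet (unit_over k V) = 1.
Proof.
rewrite /ldet size_mkseq -[RHS](det1 K k); congr (\det _).
by apply/matrixP => i j; rewrite !mxE nth_mkseq // ltn_ord.
Qed.

Lemma integral_unit_over k V :
  (forall i t, (t < k)%N -> in_val_ring val (V i t)) ->
  integral_cols val (unit_over k V).
Proof.
move=> OV t; rewrite size_mkseq => ltt i; rewrite nth_mkseq //.
case: ifP => _; last exact: OV.
by rewrite /unitcol; case: eqP => _; [exact: valring1|left].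
Qed.

(** The Schur complement depends on [l] only through [V], so it is the same on both sides and
    [ldet l] splits off. The columns replacing [l] are integral as soon as [V] is, even when [l] is
    not. *)
Lemma ldet_cat_unit_over l l2 (V : nat -> nat -> K) :
  (forall k, (k < size l)%N -> forall i, (i < size l2)%N ->
     nth (fun=> 0) l k (size l + i)%N
       = \sum_(t < size l) V i t * nth (fun=> 0) l k t) ->
  ldet (l ++ l2) = ldet l * ldet (unit_over (size l) V ++ l2).
Proof.
move=> Vl; rewrite (ldet_cat Vl) (@ldet_cat _ (unit_over _ _) _ V); last first.
  rewrite size_mkseq => k ltk i lti; rewrite nth_mkseq // ltnNge leq_addr addKn /=.
  rewrite (bigD1 (Ordinal ltk)) //= ltk /unitcol eqxx mulr1.
  rewrite big1 ?addr0 // => t; rewrite -val_eqE /= => tk.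
  by rewrite ltn_ord (negPf tk) mulr0.
by rewrite ldet_unit_over mul1r size_mkseq.
Qed.

Lemma Fl_submodular_Gr n (F : {set 'I_n} -> R) : (0 < n)%N ->
  nu_set val (@in_Fl K n) F -> submodular F ->
  exists p, nu_set val (@in_Gr K n) p /\ in_Ln p /\ phi_graph p F.
Proof.
move=> n_gt0 [q [hq [q0 Fq]]] subF.
have [a [a_upper qE]] := flag_triangular hq q0.
have D0 S : minorS a S != 0 by have := q0 S; rewrite qE mulf_eq0 negb_or => /andP[].
have FD S : F S = - val (q set0) - val (minorS a S).
  by rewrite Fq /nu qE valuM // opprD.
have Dsub (S : {set 'I_n}) i c : i \notin S -> c \notin S -> i != c ->
    val (minorS a (i |: S)) + val (minorS a (c |: S))
      <= val (minorS a S) + val (minorS a (c |: (i |: S))).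
  move=> iS cS ic; have := subF (i |: S) (c |: S).
  have -> : (i |: S) :&: (c |: S) = S.
    apply/setP => j; rewrite !inE; case: eqP => [->|_] /=.
      by rewrite (negPf iS) (negPf ic).
    by case: (j \in S); rewrite ?orbT ?andbF ?orbF.
  have -> : (i |: S) :|: (c |: S) = c |: (i |: S).
    by apply/setP => j; rewrite !inE; do !case: (_ == _); case: (_ \in _).
  by rewrite !FD; lra.
have /fin_all_exists[V VP] (S : {set 'I_n}) : exists W : nat -> nat -> K,
    forall i j, j \in S -> \sum_(t < #|S|) W i t * a j t = a j (#|S| + i)%N.
  have [W WP] := boolp.choice (fun i => minorS_solve (fun j => a j (#|S| + i)%N) (D0 S)).
  by exists W.
have OV (S : {set 'I_n}) i t : (t < #|S|)%N -> in_val_ring val (V S i t).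
  move=> ltt; apply: (row_coord_integral hv D0 Dsub a_upper ltt (leq_addr i #|S|) erefl).
  exact: VP.
(* A single block [B] serves all [S] at once; the minors to start from are all 1. *)
have [S|S|B [sB uB]] := @generic_columns _ _ _ hv hr _
    (fun S : {set 'I_n} => unit_over #|S| (V S)) n.
- by apply: integral_unit_over; apply: OV.
- by rewrite ldet_unit_over; split; [exact: oner_neq0|exact: valu1].
pose col (j : 'I_(n + n)) : nat -> K := match split j with
  | inl s => a s | inr t => nth (fun=> 0) B t end.
pose M := \matrix_(i < n, j < n + n) col j i.
have pM (C : {set 'I_(n + n)}) : #|C| = n ->
    exists2 e, val_unit val e & pminor M C = minorS a (low C) * e.
  move=> cC; rewrite (@pminor_ldet _ _ _ M col) => [|i j|//]; last by rewrite mxE.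
  rewrite enum_low_high map_cat -!map_comp.
  rewrite (@eq_map _ _ (col \o lshift n) a) => [|s]; last first.
    by rewrite /= /col (unsplitK (inl s)).
  rewrite (@eq_map _ _ (col \o @rshift n n) (fun t => nth (fun=> 0) B t)) => [|t]; last first.
    by rewrite /= /col (unsplitK (inr t)).
  have -> : [seq nth (fun=> 0) B t | t : 'I_n <- enum (high C)] =
      mask (map (mem (high C)) (enum 'I_n)) B.
    rewrite {1}/enum_mem -enumT filter_mask map_mask; congr (mask _ _).
    rewrite (map_comp (nth (fun=> 0) B) (@nat_of_ord n)).
    by rewrite [map _ (enum _)](fintype.val_enum_ord n) -sB map_nth_iota0 // take_size.
  rewrite (@ldet_cat_unit_over _ _ (V (low C))).
    by rewrite size_map -cardE; exact: (ex_intro2 _ _ _ (uB _ _) erefl).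
  rewrite size_map => k ltk i _; rewrite -cardE.
  have j : 'I_n by move: ltk; case: (enum _).
  by rewrite (nth_map j) // VP // -mem_enum mem_nth.
(* Scaling the first row by [q set0] restores the common factor of the coordinates; a first row
   exists because [n] is positive. *)
pose Q : 'M[K]_n := diag_mx (\row_j if j == Ordinal n_gt0 then q set0 else 1).
have detQ : \det Q = q set0.
  rewrite det_diag (bigD1 (Ordinal n_gt0)) //= mxE eqxx big1 ?mulr1 // => j j0.
  by rewrite mxE (negPf j0).
exists (fun C => F (low (sval C))); split; last by split=> // C D ->.
exists (fun C => pminor (Q *m M) (sval C)); split; first by exists (Q *m M).
suff H (C : ksub (n + n) n) : pminor (Q *m M) (sval C) != 0 /\
    F (low (sval C)) = nu val (pminor (Q *m M) (sval C)).
  by split=> C; case: (H C).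
have [e [e0 ve] pE] := pM _ (eqP (valP C)).
rewrite pminor_mul detQ pE /nu; split; first by rewrite !mulf_neq0.
by rewrite FD !valuM ?mulf_neq0 // ve; lra.
Qed.

End FlagToGrassmannian.

(** * From the Grassmannian to flags *)

Section GrassmannianToFlag.
Variable K : fieldType.

Lemma ldet1 (x : nat -> K) : ldet [:: x] = x 0%N.
Proof. by rewrite /ldet /= det_mx11 mxE. Qed.

Lemma ldet2 (x y : nat -> K) : ldet [:: x; y] = x 0%N * y 1%N - x 1%N * y 0%N.
Proof.
rewrite /ldet (expand_det_row _ ord0) big_ord_recl big_ord1 /cofactor !det_mx11 !mxE /=.
by rewrite expr0 expr1; ring.
Qed.

Lemma ldet_perm_cat (T : eqType) (f : T -> nat -> K) (s t : seq T) (r : seq nat) :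
  perm_eq s t -> exists b : bool,
    ldet (map f s ++ map (unitcol K) r) = (-1) ^+ b * ldet (map f t ++ map (unitcol K) r).
Proof.
move=> st; pose g (z : T + nat) := match z with inl s => f s | inr k => unitcol K k end.
have E s' : map f s' ++ map (unitcol K) r = map g (map inl s' ++ map inr r).
  by rewrite map_cat -!map_comp; congr (_ ++ _); apply: eq_map.
by rewrite !E; apply: ldet_perm; rewrite perm_cat2r perm_map.
Qed.

Lemma pminor_rank k m (M : 'M[K]_(k, m)) (C : {set 'I_m}) :
  pminor M C != 0 -> \rank M = k.
Proof.
rewrite /pminor; case: (#|C| =P k) => [e|_]; last by rewrite eqxx.
rewrite -unitfE -[_ \is a _]/(_ \in unitmx) => /mxrank_unit rk.
apply/eqP; rewrite eqn_leq rank_leq_row /= -{1}rk.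
by rewrite -{1}[M]mulmx1 -mulmx_colsub mxrankM_maxl.
Qed.

(** The minor on the last [n] columns is nonzero, so the right block [B] is invertible, and left
    multiplication by its inverse gives [[A | I]] at the cost of the constant [\det B]. *)
Lemma Gr_columns n (x : ksub (n + n) n -> K) : in_Gr x -> (forall C, x C != 0) ->
  exists (a : 'I_n -> nat -> K) (c : K), c != 0 /\ forall C : ksub (n + n) n,
    x C = c * ldet (map a (enum (low (val C))) ++
                    map (unitcol K) (map val (enum (high (val C))))).
Proof.
move=> [M xM] x0; pose B := rsubmx M.
have uB : B \in unitmx.
  have cC : #|join (set0 : {set 'I_n}) setT| == n.
    by rewrite -card_low_high low_join high_join cards0 cardsT card_ord.
  have := x0 (exist (fun C : {set _} => #|C| == n) _ cC).
  rewrite xM /= pminor_colfun ?(eqP cC) //.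
  rewrite /minorS enum_low_high low_join high_join map_cat enum_set0 /= -map_comp.
  rewrite (@eq_map _ _ _ (colfun B)) => [|t]; last first.
    by rewrite /= /colfun /B; apply: boolp.funext => i; case: insub => //= i'; rewrite mxE.
  rewrite -/(minorS _ _) -pminor_colfun ?cardsT ?card_ord // -[B]mulmx1 pminor_mul.
  by rewrite mulmx1 mulf_eq0 negb_or => /andP[]; rewrite unitmxE unitfE.
pose M1 := invmx B *m M.
have M1r (i t : 'I_n) : M1 i (rshift n t) = (i == t)%:R.
  have : rsubmx M1 = 1%:M by rewrite /M1 -[M]hsubmxK mul_mx_row row_mxKr mulVmx.
  by move/matrixP/(_ i t); rewrite !mxE.
exists (fun s => colfun M1 (lshift n s)), (\det B); split.
  by rewrite -unitfE -unitmxE.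
move=> C; rewrite xM -[M](mulKVmx uB) pminor_mul -/M1; congr (_ * _).
pose col (j : 'I_(n + n)) : nat -> K := match split j with
  | inl s => colfun M1 (lshift n s) | inr t => unitcol K t end.
rewrite (@pminor_ldet _ _ _ M1 col) => [|i j|]; last 1 first.
- exact/eqP/(valP C).
- rewrite enum_low_high map_cat -!map_comp; congr (ldet (_ ++ _)); apply: eq_map => s.
    by rewrite /= /col (unsplitK (inl s)).
  by rewrite /= /col (unsplitK (inr s)).
rewrite /col; case: (split_ordP j) => s ->; first by rewrite colfunE.
by rewrite M1r.
Qed.

Section IndexElements.
Variable n : nat.

Lemma card_join (S T : {set 'I_n}) : #|join S T| = (#|S| + #|T|)%N.
Proof. by rewrite -card_low_high low_join high_join. Qed.

Lemma card_set_le (S : {set 'I_n}) : (#|S| <= n)%N.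
Proof. by rewrite -[n in (_ <= n)%N]card_ord max_card. Qed.

Lemma flag_index_proof (S : {set 'I_n}) : #|join S (from n #|S|)| == n.
Proof. by rewrite card_join card_from ?card_set_le // subnKC ?card_set_le. Qed.

(** The completion of [S] for which the minor of [[A | I]] is the leading minor of A on [S]. *)
Definition flag_index (S : {set 'I_n}) : ksub (n + n) n :=
  exist (fun C : {set _} => #|C| == n) _ (flag_index_proof S).

(** With [k + 1] left columns, these unit columns leave the rows [0, ..., k - 1] and [k + 1]: this
    gives the minors of the three-term relation that are not leading. *)
Definition skip k : {set 'I_n} := [set t : 'I_n | (val t == k) || (k.+1 < t)%N].

Lemma val_enum_skip k : (k.+1 < n)%N ->
  map val (enum (skip k)) = k :: iota k.+2 (n - k.+2).
Proof.
move=> kn; rewrite (val_enum_set n (fun t => (t == k) || (k.+1 < t)%N)).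
have -> : iota 0 n = iota 0 k ++ [:: k, k.+1 & iota k.+2 (n - k.+2)].
  by rewrite {1}(_ : n = k + (n - k.+2).+2)%N ?iotaD //; lia.
rewrite filter_cat.
rewrite (@eq_in_filter _ _ xpred0) ?filter_pred0; last first.
  by move=> i; rewrite mem_iota add0n => /andP[_ ik]; lia.
rewrite /= eqxx /= ifF; last by lia.
congr (_ :: _); rewrite (@eq_in_filter _ _ xpredT) ?filter_predT //.
by move=> i; rewrite mem_iota => /andP[ki _]; rewrite ki orbT.
Qed.

Lemma card_skip k : (k.+1 < n)%N -> #|skip k| = (n - k.+1)%N.
Proof.
by move=> kn; rewrite cardE -(size_map val) val_enum_skip //= size_iota; lia.
Qed.

Lemma skip_index (S : {set 'I_n}) k : #|S| = k.+1 -> (k.+1 < n)%N ->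
  exists C : ksub (n + n) n, val C = join S (skip k).
Proof.
move=> cS kn; have cC : #|join S (skip k)| == n.
  by rewrite card_join card_skip // cS subnKC // ltnW.
by exists (exist (fun C : {set _} => #|C| == n) _ cC).
Qed.

End IndexElements.

Section Valued.
Variables (R : realType) (val : K -> R).
Hypothesis hv : nonarch_valuation val.
Variable n : nat.

Lemma flag_index_minor (x : ksub (n + n) n -> K) (a : 'I_n -> nat -> K) c :
  (forall C : ksub (n + n) n,
    x C = c * ldet (map a (enum (low (\val C))) ++
                    map (unitcol K) (map \val (enum (high (\val C)))))) ->
  forall S, x (flag_index S) = c * minorS a S.
Proof.
move=> xE S; rewrite xE /= low_join high_join val_enum_from ?card_set_le //.
by rewrite {1}cardE -(size_map a) ldet_cat_unitcol.
Qed.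

Lemma nu_Gr_Fl (p : ksub (n + n) n -> R) : nu_set val (@in_Gr K n) p ->
  nu_set val (@in_Fl K n) (fun S => p (flag_index S)).
Proof.
move=> [x [xGr [x0 px]]]; have [a [c [c0 xE]]] := Gr_columns xGr x0.
have xF := flag_index_minor xE.
exists (fun S => x (flag_index S)); split; last by split=> S.
pose M k := \matrix_(i < k, j < n) a j i.
have pM (S : {set 'I_n}) : pminor (M #|S|) S = minorS a S.
  by apply: pminor_ldet => // i j; rewrite mxE.
exists M, (fun=> c); split.
  move=> k kn; apply: (@pminor_rank _ _ _ (upto n k)).
  have := pM (upto n k); rewrite card_upto // => ->.
  by apply: contraNneq (x0 (flag_index (upto n k))) => E; rewrite xF E mulr0.
split; last by split=> // S; rewrite xF pM.
move=> k kn; apply/row_subP => i.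
have -> : row i (M k) = row (widen_ord (leqnSn k) i) (M k.+1).
  by apply/rowP => j; rewrite !mxE.
exact: row_sub.
Qed.

(* The three-term Pluecker relation for S + {i, j} and two unit columns. *)
Lemma nu_Gr_exchange (S : {set 'I_n}) i j : i \notin S -> j \notin S -> i != j ->
  exists Ci Cj : ksub (n + n) n, low (\val Ci) = i |: S /\ low (\val Cj) = j |: S /\
  forall p : ksub (n + n) n -> R, nu_set val (@in_Gr K n) p ->
    p (flag_index (j |: (i |: S))) + p (flag_index S)
     <= Num.max (p (flag_index (i |: S)) + p Cj) (p Ci + p (flag_index (j |: S))).
Proof.
move=> iS jS ij; set k := #|S|.
have jiS : j \notin i |: S by rewrite !inE eq_sym (negPf ij).
have cU : #|j |: (i |: S)| = k.+2 by rewrite !cardsU1 iS jiS.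
have kn : (k.+1 < n)%N by rewrite -cU card_set_le.
have [||Ci CiE] := @skip_index n (i |: S) k; rewrite ?cardsU1 ?iS //.
have [||Cj CjE] := @skip_index n (j |: S) k; rewrite ?cardsU1 ?jS //.
(* Both are fixed before [p], so the same relation holds for all points and can be used for
   limits. *)
exists Ci, Cj; rewrite CiE CjE !low_join; do 2!split=> //.
move=> p [x [xGr [x0 px]]]; have [a [c [c0 xE]]] := Gr_columns xGr x0.
have xF := flag_index_minor xE.
have pS (T : {set 'I_n}) r : r \notin T -> perm_eq (enum (r |: T)) (rcons (enum T) r).
  move=> rT; apply: uniq_perm; rewrite ?enum_uniq ?rcons_uniq ?mem_enum ?rT ?enum_uniq //.
  by move=> z; rewrite mem_rcons in_cons !mem_enum !inE.
pose l := map a (enum S).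
have sl : size l = k by rewrite size_map -cardE.
have sgn y (b : bool) z : y != 0 -> y = (-1) ^+ b * z -> z != 0 /\ val y = val z.
  by move=> y0 yE; move: y0; rewrite yE val_sign // mulf_eq0 signr_eq0.
(* The columns of [S] move to the front, followed by [r] and the unit column [k]; the later unit
   columns drop out. *)
have vC C r : r \notin S -> \val C = join (r |: S) (skip n k) ->
    c * ldet (l ++ [:: a r; unitcol K k]) != 0 /\
    val (x C) = val (c * ldet (l ++ [:: a r; unitcol K k])).
  move=> rS CE.
  have [b E] := ldet_perm_cat a (k :: iota k.+2 (n - k.+2)) (pS _ _ rS).
  apply: (sgn _ b) => //; rewrite xE CE low_join high_join val_enum_skip // E.
  rewrite mulrCA map_rcons -/l -cats1 -catA /= -[_ :: _ :: _]/([:: _; _] ++ _) catA.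
  rewrite -[X in iota X _](_ : size (l ++ [:: a r; unitcol K k]) = _) ?ldet_cat_unitcol //.
  by rewrite size_cat sl addn2.
have v1 r : r \notin S -> c * ldet (l ++ [:: a r]) != 0 /\
    val (x (flag_index (r |: S))) = val (c * ldet (l ++ [:: a r])).
  move=> rS; have [b E] := ldet_perm a (pS _ _ rS); apply: (sgn _ b) => //.
  by rewrite xF /minorS E mulrCA map_rcons -cats1.
have v2 : c * ldet (l ++ [:: a i; a j]) != 0 /\
    val (x (flag_index (j |: (i |: S)))) = val (c * ldet (l ++ [:: a i; a j])).
  have p2 : perm_eq (enum (j |: (i |: S))) (enum S ++ [:: i; j]).
    apply: perm_trans (pS _ _ jiS) _; rewrite -cats1 -[[:: i; j]]/([:: i] ++ [:: j]) catA.
    by rewrite perm_cat2r cats1; apply: pS.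
  have [b E] := ldet_perm a p2; apply: (sgn _ b) => //.
  by rewrite xF /minorS E mulrCA map_cat.
have d0 : ldet l != 0.
  by apply: contraNneq (x0 (flag_index S)) => E; rewrite xF /minorS E mulr0.
have [W WP] := boolp.choice (fun t => ldet_solve (fun s => nth (fun=> 0) l s (k + t)%N) d0).
(* The Schur complement against the columns [S] reduces everything to determinants of size at most 2
   in rows [k] and [k + 1]. *)
pose sch (y : nat -> K) t := y (k + t)%N - \sum_(s < k) W t s * y s.
have schE l2 : ldet (l ++ l2) = ldet l * ldet (map sch l2).
  by rewrite (@ldet_cat _ _ _ W) sl // => s lts t _; rewrite -WP ?sl.
have sch_unit t : sch (unitcol K k) t = (t == 0)%:R.
  rewrite /sch big1 ?subr0 => [|s _]; last by rewrite /unitcol ltn_eqF // mulr0.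
  by rewrite /unitcol -[X in _ == X]addn0 eqn_add2l.
have schC r : ldet (l ++ [:: a r; unitcol K k]) = - (ldet l * sch (a r) 1%N).
  by rewrite schE /= ldet2 !sch_unit /= mulr0 mulr1 sub0r mulrN.
have sch1 r : ldet (l ++ [:: a r]) = ldet l * sch (a r) 0%N by rewrite schE ldet1.
have [] := vC _ _ iS CiE; have [] := vC _ _ jS CjE; have [] := v1 i iS; have [] := v1 j jS.
have [] := v2; rewrite !schC !sch1 schE /= ldet2 !px /nu (xF S).
set X0 := sch (a i) 0%N; set X1 := sch (a i) 1%N.
set Y0 := sch (a j) 0%N; set Y1 := sch (a j) 1%N.
rewrite !mulrN !oppr_eq0 !mulf_eq0 !(negPf c0) !(negPf d0) /= => s0 ->.
move=> Y00 -> X00 -> Y10 -> X10 ->; rewrite !(valuN hv) /minorS -/l !valuM ?mulf_neq0 //.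
(* Up to a common factor, the minor on [S] with [i] and [j] is a nonzero difference of two products,
   so its valuation is at least the smaller of theirs. *)
have : val (X0 * Y1) <= val (X0 * Y1 - X1 * Y0) \/ val (X1 * Y0) <= val (X0 * Y1 - X1 * Y0).
  apply/orP; rewrite -ge_min -(valuN hv (X1 * Y0)).
  by apply: hv.2; rewrite ?oppr_eq0 ?mulf_neq0.
by rewrite !valuM // le_max => h; apply/orP; case: h => h; [left|right]; lra.
Qed.

End Valued.
End GrassmannianToFlag.

(** * Submodularity from its local form *)

Section Submodularity.
Variables (R : realType) (n : nat) (F : {set 'I_n} -> R).

(** Removing the elements of [T :\: S] from [T] one by one gives diminishing returns ([marg]). A
    second induction removes the elements of [S :\: T] from [S], comparing marginal values at
    [S :\ i] and at its union with [T]. *)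
Lemma submodular_of_local :
  (forall (S : {set 'I_n}) i j, i \notin S -> j \notin S -> i != j ->
     F (j |: (i |: S)) + F S <= F (i |: S) + F (j |: S)) ->
  submodular F.
Proof.
move=> loc.
have marg (S T : {set 'I_n}) i : S \subset T -> i \notin T ->
    F (i |: T) - F T <= F (i |: S) - F S.
  have [d] := ubnP #|T :\: S|; elim: d T => // d IH T ltd ST iT.
  have [TS|/subsetPn[j jT jS]] := boolP (T \subset S).
    by rewrite (_ : T = S) //; apply/eqP; rewrite eqEsubset TS.
  have ji : i != j by apply: contraNneq iT => ->.
  have ST0 : S \subset T :\ j by rewrite subsetD1 ST jS.
  have iT0 : i \notin T :\ j by rewrite !inE (negPf iT) andbF.
  have := loc (T :\ j) i j iT0 _ ji; rewrite !inE eqxx setUCA setD1K // => /(_ isT) h.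
  have : F (i |: (T :\ j)) - F (T :\ j) <= F (i |: S) - F S.
    apply: IH => //; rewrite -ltnS; apply: leq_trans ltd; rewrite ltnS.
    apply: proper_card; apply/properP; split; first by rewrite setSD ?subD1set.
    by exists j; rewrite !inE ?jS ?jT ?eqxx.
  by lra.
move=> S T; have [d] := ubnP #|S :\: T|; elim: d S => // d IH S ltd.
have [ST|/subsetPn[i iS iT]] := boolP (S \subset T).
  by rewrite (setIidPl ST) (setUidPr ST).
have S0T : (#|(S :\ i) :\: T| < d)%N.
  rewrite -ltnS; apply: leq_trans ltd; rewrite ltnS.
  apply: proper_card; apply/properP; split; first by rewrite setSD ?subD1set.
  by exists i; rewrite !inE ?iS ?iT ?eqxx.
have := IH _ S0T.
have -> : (S :\ i) :&: T = S :&: T.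
  by apply/setP => j; rewrite !inE; have [->|_] := eqVneq j i; rewrite ?(negPf iT) ?andbF.
have := marg (S :\ i) ((S :\ i) :|: T) i (subsetUl _ _).
by rewrite setUA setD1K // !inE eqxx (negPf iT) => /(_ isT); lra.
Qed.

End Submodularity.

(** * Points of the tropical Grassmannian in L_n *)

Section TropicalGrassmannian.
Variables (R : realType) (K : fieldType) (val : K -> R).
Hypothesis hv : nonarch_valuation val.
Variables (n : nat) (p : ksub (n + n) n -> R) (F : {set 'I_n} -> R).
Hypothesis pF : phi_graph p F.

Lemma phi_flag_index S : p (flag_index S) = F S.
Proof. by rewrite -pF /= low_join. Qed.

Lemma trop_Gr_Fl : trop val (@in_Gr K n) p -> trop val (@in_Fl K n) F.
Proof.
move=> tp eps /tp[p' [p'Gr pp']].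
exists (fun S => p' (flag_index S)); split; first exact: nu_Gr_Fl.
by move=> S; rewrite -phi_flag_index.
Qed.

(** Since [p] depends only on the left part of its argument, both arguments of the maximum in the
    exchange inequality become [F (i |: S) + F (j |: S)], and the inequality passes to the
    closure. *)
Lemma trop_Gr_submodular : trop val (@in_Gr K n) p -> submodular F.
Proof.
move=> tp; apply: submodular_of_local => S i j iS jS ij.
have [Ci [Cj [CiE [CjE H]]]] := nu_Gr_exchange hv iS jS ij.
rewrite leNgt; apply/negP => lt.
set L := F (i |: S) + F (j |: S) in lt; set U := _ + F S in lt.
(* In either alternative four values are compared, each moved by less than a fifth of the gap. *)
have [|p' [/H p'Gr pp']] := tp ((U - L) / 5); first by lra.
have := pp' (flag_index (j |: (i |: S))); have := pp' (flag_index S).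
have := pp' (flag_index (i |: S)); have := pp' (flag_index (j |: S)).
have := pp' Ci; have := pp' Cj.
rewrite !phi_flag_index -!pF CiE CjE !ltr_norml.
move: p'Gr; rewrite le_max => h h1 h2 h3 h4 h5 h6.
rewrite /U /L in lt h1 h2 h3 h4 h5 h6.
case/orP: h => h; clear -lt h1 h2 h3 h4 h5 h6 h; lra.
Qed.

End TropicalGrassmannian.

(** * Repairing submodularity near a tropical flag *)

Section TropicalFlags.
Variables (R : realType) (K : fieldType) (val : K -> R).
Hypothesis hv : nonarch_valuation val.

(** Up to sign every nonzero element has a square root, and signs do not change [val], so the value
    group is closed under halving. *)
Lemma small_value : nontrivial_val val -> alg_closed K \/ real_closed_compat val ->
  forall eps, 0 < eps -> exists y, y != 0 /\ 0 < val y < eps.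
Proof.
move=> [x [x0 vx]] cl eps e0.
have [z [z0 vz]] : exists z, z != 0 /\ 0 < val z.
  have [lt|gt|/eqP] := ltgtP (val x) 0; last by rewrite (negPf vx).
    by exists x^-1; rewrite invr_eq0 valuV // oppr_gt0.
  by exists x.
have half w : w != 0 -> exists y, y != 0 /\ val y *+ 2 = val w.
  move=> w0; suff [y [b yw]] : exists y (b : bool), y ^+ 2 = (-1) ^+ b * w.
    have y0 : y != 0 by rewrite -sqrf_eq0 yw mulf_neq0 ?signr_eq0.
    by exists y; rewrite -valuX // yw val_sign.
  case: cl => [ac|[E [f [[g fK gK] _]]]].
    have [//|y yE] := ac 2%N (fun i => if i == 0%N then w else 0).
    exists y, false; rewrite yE !big_ord_recl big_ord0 /=.
    by rewrite mul0r !addr0 !mul1r mulr1.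
  exists (g (Num.sqrt `|f w|)).
  have sq : f (g (Num.sqrt `|f w|) ^+ 2) = `|f w| by rewrite rmorphXn gK /= sqr_sqrtr.
  have [fw|fw] := leP 0 (f w).
    by exists false; apply: (can_inj fK); rewrite sq mul1r ger0_norm.
  by exists true; apply: (can_inj fK); rewrite sq mulN1r rmorphN /= ltr0_norm.
have pow m : exists y, y != 0 /\ val y * 2 ^+ m = val z.
  elim: m => [|m [y [y0 vy]]]; first by exists z; rewrite mulr1.
  have [y' [y'0 vy']] := half y y0; exists y'; split=> //.
  by rewrite exprS mulrA mulr_natr vy'.
(* Archimedean choice of the number [m] of halvings: [2 ^ m] exceeds [val z / eps]. *)
have [y [y0 vy]] := pow (Num.bound (val z / eps)).
exists y; split=> //.
have h := upper_nthrootP (leqnn (Num.bound (val z / eps))).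
set t := 2 ^+ _ in vy h; have t0 : 0 < t by rewrite exprn_gt0.
apply/andP; split; first by rewrite -(pmulr_lgt0 _ t0) vy.
by rewrite -(ltr_pM2r t0) vy mulrC -ltr_pdivrMr.
Qed.

(** The free scalars [c k] absorb a factor [y ^ (k ^ 2)] on the coordinates of level [k]; the minus
    sign is that of [nu]. *)
Lemma nu_Fl_scale n (F : {set 'I_n} -> R) y : y != 0 -> nu_set val (@in_Fl K n) F ->
  nu_set val (@in_Fl K n) (fun S => F S - val y * #|S|%:R ^+ 2).
Proof.
move=> y0 [q [[M [c [rM [nM [c0 qE]]]]] [q0 Fq]]].
exists (fun S : {set 'I_n} => y ^+ (#|S| ^ 2)%N * q S); split; last split.
- exists M, (fun k => y ^+ (k ^ 2)%N * c k); do 2!split=> //; split.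
    by move=> k kn; rewrite mulf_neq0 ?expf_neq0 ?c0.
  by move=> S; rewrite qE mulrA.
- by move=> S; rewrite mulf_neq0 ?expf_neq0.
move=> S; rewrite /nu valuM ?expf_neq0 // Fq /nu valuX // -[val y *+ _]mulr_natr natrX.
by lra.
Qed.

(* A function of #|S| only is realised by rescaling the flag coordinates, so a
   small multiple of the strictly submodular - #|S|^2 repairs the
   submodularity lost in approximating F. *)
Lemma trop_Fl_submodular_approx n (F : {set 'I_n} -> R) :
  (forall eps, 0 < eps -> exists y, y != 0 /\ 0 < val y < eps) ->
  trop val (@in_Fl K n) F -> submodular F ->
  forall eps, 0 < eps -> exists G, [/\ nu_set val (@in_Fl K n) G, submodular G &
    forall S, `|F S - G S| < eps].
Proof.
move=> small tF subF eps e0.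
have N0 : 0 < (n%:R ^+ 2 + 1 : R) by rewrite ltr_wpDl ?sqr_ge0.
(* The correction is at most [val y * n ^ 2] and the approximation error is below [val y / 2], hence
   the divisor [n ^ 2 + 1]. *)
have [y [y0 /andP[vy0 vye]]] := small _ (divr_gt0 e0 N0).
rewrite ltr_pdivlMr // in vye.
(* Four errors below [val y / 2] add up to less than [2 * val y]. For incomparable [S] and [T] the
   quadratic term gains [2 * val y * #|S :\: T| * #|T :\: S|], which is at least [2 * val y]. *)
have [|F' [F'Fl FF']] := tF (val y / 2); first by lra.
exists (fun S : {set 'I_n} => F' S - val y * #|S|%:R ^+ 2); split; first exact: nu_Fl_scale.
  move=> S T.
  have [ST|/subsetPn[i iS iT]] := boolP (S \subset T).
    by rewrite (setIidPl ST) (setUidPr ST).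
  have [TS|/subsetPn[j jT jS]] := boolP (T \subset S).
    by rewrite (setIidPr TS) (setUidPl TS) addrC.
  have A0 : (0 < #|S :\: T|)%N by apply/card_gt0P; exists i; rewrite inE iT.
  have B0 : (0 < #|T :\: S|)%N by apply/card_gt0P; exists j; rewrite inE jS.
  have := subF S T; have := FF' S; have := FF' T; have := FF' (S :&: T).
  have := FF' (S :|: T); rewrite !ltr_norml => h1 h2 h3 h4 h5.
  have cU : #|S :|: T| = (#|S :&: T| + #|S :\: T| + #|T :\: S|)%N.
    clear; apply: (@addIn #|S :&: T|).
    by rewrite cardsUI -(cardsID T S) -(cardsID S T) (setIC T S); ring.
  have AB : val y <= val y * (#|S :\: T|%:R * #|T :\: S|%:R).
    by rewrite ler_peMr ?(ltW vy0) // -natrM ler1n muln_gt0 A0.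
  rewrite cU -(cardsID T S) -(cardsID S T) (setIC T S) !natrD.
  move: #|S :&: T|%:R #|S :\: T|%:R #|T :\: S|%:R AB => x A B AB.
  clear -h1 h2 h3 h4 h5 AB.
  move: h1 h2 h3 h4 h5 AB; move: (val y) (F _) (F' _) (F _) (F' _) (F _) (F' _) (F _) (F' _).
  move=> g f1 g1 f2 g2 f3 g3 f4 g4 => h1 h2 h3 h4 h5 AB.
  by lra.
move=> S; have := FF' S; rewrite !ltr_norml.
have : val y * #|S|%:R ^+ 2 <= val y * n%:R ^+ 2.
  by rewrite ler_wpM2l ?(ltW vy0) // lerXn2r ?nnegrE ?ler_nat ?card_set_le.
have : 0 <= val y * #|S|%:R ^+ 2 by rewrite mulr_ge0 ?(ltW vy0) ?sqr_ge0.
by lra.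
Qed.

End TropicalFlags.

(** * The exact and the tropical equality *)

Theorem theorem3p2 (R : realType) (K : fieldType) (val : K -> R) :
  nonarch_valuation val -> nontrivial_val val -> has_splitting val ->
  infinite_residue_field val ->
  forall n : nat, (0 < n)%N ->
    (forall F : {set 'I_n} -> R,
       (exists p, nu_set val (@in_Gr K n) p /\ in_Ln p /\ phi_graph p F) <->
       (nu_set val (@in_Fl K n) F /\ submodular F)) /\
    (alg_closed K \/ real_closed_compat val ->
     forall F : {set 'I_n} -> R,
       (exists p, trop val (@in_Gr K n) p /\ in_Ln p /\ phi_graph p F) <->
       (trop val (@in_Fl K n) F /\ submodular F)).
Proof.
move=> hv hnt _ hr n n_gt0.
split=> [F|cl F]; split.
- move=> [p [pGr [_ pF]]]; split.
    have [q [qFl [q0 qp]]] := nu_Gr_Fl pGr.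
    by exists q; do 2!split=> //; move=> S; rewrite -(phi_flag_index pF).
  (* A point of [nu(Gr)] lies in the closure, so the closed statement covers the exact one. *)
  apply: (trop_Gr_submodular hv pF) => eps e0; exists p; split=> // C.
  by rewrite subrr normr0.
- by move=> [FFl Fsub]; apply: Fl_submodular_Gr.
- move=> [p [pGr [_ pF]]]; split; first exact: trop_Gr_Fl pF pGr.
  exact (trop_Gr_submodular hv pF pGr).
- move=> [tF Fsub]; exists (fun C => F (low (sval C))); split; last first.
    by split=> // C D ->.
  move=> eps e0.
  (* The lift of [F] is approximated by the lift of a nearby submodular [G] in [nu(Fl)], to which
     the exact inclusion applies. *)
  have [G [GFl Gsub FG]] :=
    trop_Fl_submodular_approx hv (small_value hv hnt cl) tF Fsub e0.
  have [p [pGr [_ pG]]] := Fl_submodular_Gr hv hr n_gt0 GFl Gsub.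
  by exists p; split=> // C; rewrite -pG; apply: FG.
Qed.
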